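(* Let $(X,d)$ be a coarsely connected metric space and $G$ a finitely generated group. Then $X$ admits a proper, cobounded coarse near-action by $G$ if and only if $X$ is coarsely equivalent to $G$.
   Context: A finitely generated group is given the word metric with respect to some finite generating set. Let $(X,d)$ and $(Y,d')$ be metric spaces. Let $\rho_-,\rho_+:[0,\infty)\to[0,\infty)$ be nondecreasing with $\rho_-(r)\to\infty$ as $r\to\infty$. A (not necessarily continuous) function $f:X\to Y$ is a $(\rho_-,\rho_+)$-coarse embedding if $\rho_-(d(x_1,x_2))\le d'(f(x_1),f(x_2))\le\rho_+(d(x_1,x_2))$ for all $x_1,x_2\in X$; $f$ is coarsely surjective if there is $C\ge0$ such that every $y\in Y$ satisfies $d'(y,f(x))\le C$ for some $x\in X$; $f$ is a coarse equivalence if it is a coarse embedding (for some such $\rho_\pm$) and coarsely surjective. Two metric spaces are coarsely equivalent if there is a coarse equivalence between them. A coarse near-action of a group $G$ on $(X,d)$ is a function $\psi$ assigning to each $\gamma\in G$ a function $\psi(\gamma):X\to X$ such that, for some $C\ge 0$ and some pair $(\rho_-,\rho_+)$ of nondecreasing functions $[0,\infty)\to[0,\infty)$ with $\rho_-(r)\to\infty$ as $r\to\infty$ (independent of $\gamma$): $d(\psi(1)(x),x)\le C$ for all $x\in X$; $d(\psi(\gamma_1\gamma_2)(x),\psi(\gamma_1)\psi(\gamma_2)(x))\le C$ for all $x\in X$, $\gamma_1,\gamma_2\in G$; and every $\psi(\gamma)$ is a $(\rho_-,\rho_+)$-coarse embedding. It is cobounded if there exist $x_0\in X$ and $R>0$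 such that for all $y\in X$ there is $\gamma\in G$ with $d(\psi(\gamma)(x_0),y)<R$. It is proper if for each $R>0$ there is $M\in\mathbb{N}$ such that for all $x,y\in X$, $|\{\gamma\in G : \psi(\gamma)(B_d[x,R])\cap B_d[y,R]\ne\emptyset\}|\le M$, where $B_d[x,R]$ is the closed ball. $(X,d)$ is coarsely connected if there exists $R>0$ such that for all $x,x'\in X$ there is a finite sequence $x=x_0,x_1,\dots,x_n=x'$ in $X$ with $d(x_i,x_{i+1})\le R$ for $0\le i\le n-1$. *)

(* Defs.v *)
From HB Require Import structures.
From mathcomp Require Import all_boot all_order all_algebra.
From mathcomp Require Import boolp classical_sets cardinality reals topology.
From mathcomp Require Import normedtype.

Set Implicit Arguments.
Unset Strict Implicit.
Unset Printing Implicit Defensive.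

Import Order.TTheory GRing.Theory Num.Theory.
Import numFieldNormedType.Exports.

Local Open Scope classical_set_scope.
Local Open Scope ring_scope.

(* Functions [0, oo) -> [0, oo) are represented by functions R -> R whose
   values at negative arguments are irrelevant; only arguments r >= 0 are ever
   constrained or used. *)
Definition nondecreasing_control (R : realType) (rho : R -> R) : Prop :=
  (forall r, 0 <= r -> 0 <= rho r) /\
  (forall r s, 0 <= r -> r <= s -> rho r <= rho s).

Definition control_pair (R : realType) (rho_m rho_p : R -> R) : Prop :=
  [/\ nondecreasing_control rho_m, nondecreasing_control rho_p
    & rho_m r @[r --> +oo] --> +oo].

Definition coarse_embedding (R : realType) (X Y : metricType R)
    (rho_m rho_p : R -> R) (f : X -> Y) : Prop :=
  forall x1 x2 : X,
    rho_m (mdist x1 x2) <= mdist (f x1) (f x2) <= rho_p (mdist x1 x2).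

Definition coarsely_surjective (R : realType) (X Y : metricType R)
    (f : X -> Y) : Prop :=
  exists2 C : R, 0 <= C & forall y : Y, exists x : X, mdist y (f x) <= C.

Definition coarse_equivalence (R : realType) (X Y : metricType R)
    (f : X -> Y) : Prop :=
  (exists rho_m rho_p : R -> R,
     control_pair rho_m rho_p /\ coarse_embedding rho_m rho_p f) /\
  coarsely_surjective f.

Definition coarsely_equivalent (R : realType) (X Y : metricType R) : Prop :=
  exists f : X -> Y, coarse_equivalence f.

Definition coarsely_connected (R : realType) (X : metricType R) : Prop :=
  exists2 r : R, 0 < r & forall x x' : X, exists s : seq X,
    path (fun y z => mdist y z <= r) x s /\ last x s = x'.

Definition coarse_near_action (R : realType) (X : metricType R)
    (G : groupType) (psi : G -> X -> X) : Prop :=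
  exists (C : R) (rho_m rho_p : R -> R),
    [/\ 0 <= C /\ control_pair rho_m rho_p,
        forall x : X, mdist (psi 1%g x) x <= C,
        forall (x : X) (g1 g2 : G),
          mdist (psi (g1 * g2)%g x) (psi g1 (psi g2 x)) <= C
      & forall g : G, coarse_embedding rho_m rho_p (psi g)].

Definition cobounded (R : realType) (X : metricType R) (G : groupType)
    (psi : G -> X -> X) : Prop :=
  exists (x0 : X) (r : R), 0 < r /\
    forall y : X, exists g : G, mdist (psi g x0) y < r.

(* The library's closed_ball is the topological closure of the open ball, which
   may be strictly smaller than the set below. *)
Definition mclosed_ball (R : realType) (X : metricType R) (x : X) (r : R) :
  set X := [set y | mdist x y <= r].

Definition proper_near_action (R : realType) (X : metricType R)
    (G : groupType) (psi : G -> X -> X) : Prop :=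
  forall r : R, 0 < r -> exists M : nat, forall x y : X,
    ([set g | (psi g @` mclosed_ball x r) `&` mclosed_ball y r !=set0]
      #<= `I_M)%card.

Definition word_for (G : groupType) (S : seq G) (w : seq G) (g : G) : Prop :=
  all (fun s => (s \in S) || (s^-1%g \in S)) w /\ (\prod_(s <- w) s)%g = g.

Definition generates (G : groupType) (S : seq G) : Prop :=
  forall g : G, exists w : seq G, word_for S w g.

Lemma word_length_ex (G : groupType) (S : seq G) (genS : generates S) (g : G) :
  exists n, `[< exists2 w : seq G, size w = n & word_for S w g >].
Proof. by have [w ww] := genS g; exists (size w); apply/asboolP; exists w. Qed.

Definition word_length (G : groupType) (S : seq G) (genS : generates S)
  (g : G) : nat := ex_minn (word_length_ex genS g).

Lemma word_lengthP (G : groupType) (S : seq G) (genS : generates S) (g : G) :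
  exists2 w : seq G, size w = word_length genS g & word_for S w g.
Proof. by rewrite /word_length; case: ex_minnP => n /asboolP. Qed.

Lemma word_length_le (G : groupType) (S : seq G) (genS : generates S)
  (g : G) (w : seq G) : word_for S w g -> (word_length genS g <= size w)%N.
Proof.
move=> ww; rewrite /word_length; case: ex_minnP => n _; apply.
by apply/asboolP; exists w.
Qed.

Lemma word_length1 (G : groupType) (S : seq G) (genS : generates S) :
  word_length genS 1%g = 0%N.
Proof.
apply/eqP; rewrite -leqn0; apply: (@word_length_le _ _ _ _ [::]).
by split; rewrite ?big_nil.
Qed.

Lemma word_length_eq0 (G : groupType) (S : seq G) (genS : generates S)
  (g : G) : word_length genS g = 0%N -> g = 1%g.
Proof.
have [w <- [_ <-]] := word_lengthP genS g.
by move/size0nil => ->; rewrite big_nil.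
Qed.

Lemma word_lengthM (G : groupType) (S : seq G) (genS : generates S)
  (g h : G) :
  (word_length genS (g * h)%g <= word_length genS g + word_length genS h)%N.
Proof.
have [v <- [Sv <-]] := word_lengthP genS g.
have [w <- [Sw <-]] := word_lengthP genS h.
rewrite -size_cat; apply: word_length_le; split; first by rewrite all_cat Sv.
by rewrite big_cat.
Qed.

Lemma word_lengthV_le (G : groupType) (S : seq G) (genS : generates S)
  (g : G) : (word_length genS g^-1%g <= word_length genS g)%N.
Proof.
have [w <- [Sw <-]] := word_lengthP genS g.
rewrite -(size_rev w) -(size_map (fun s : G => s^-1%g)).
apply: word_length_le; split.
  rewrite all_map all_rev; apply: sub_all Sw => s /=.
  by rewrite invgK orbC.
elim: w {Sw} => [|s w IHw]; first by rewrite /rev /= !big_nil invg1.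
by rewrite rev_cons map_rcons -cats1 big_cat big_seq1 IHw big_cons invgM.
Qed.

Lemma word_lengthV (G : groupType) (S : seq G) (genS : generates S)
  (g : G) : word_length genS g^-1%g = word_length genS g.
Proof.
apply/eqP; rewrite eqn_leq word_lengthV_le /=.
by rewrite -{1}(invgK g) word_lengthV_le.
Qed.

(* The group G, as a metric space for the left-invariant word metric of S. *)
Definition word_metric_space (R : realType) (G : groupType) (S : seq G)
  (genS : generates S) : Type := G.

HB.instance Definition _ (R : realType) (G : groupType) (S : seq G)
  (genS : generates S) := Choice.on (@word_metric_space R G S genS).

Definition word_dist (R : realType) (G : groupType) (S : seq G)
  (genS : generates S) (g h : G) : R := (word_length genS (g^-1 * h)%g)%:R.

Lemma word_distxx (R : realType) (G : groupType) (S : seq G)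
  (genS : generates S) (g : G) : word_dist R genS g g = 0.
Proof. by rewrite /word_dist mulVg word_length1. Qed.

Lemma word_dist_positivity (R : realType) (G : groupType) (S : seq G)
  (genS : generates S) (g h : G) : word_dist R genS g h = 0 -> g = h.
Proof.
move/eqP; rewrite pnatr_eq0 => /eqP/word_length_eq0 gh.
by rewrite -[h]mul1g -(mulgV g) -mulgA gh mulg1.
Qed.

Lemma word_dist_sym (R : realType) (G : groupType) (S : seq G)
  (genS : generates S) (g h : G) : word_dist R genS g h = word_dist R genS h g.
Proof. by rewrite /word_dist -word_lengthV invgM invgK. Qed.

Lemma word_dist_triangle (R : realType) (G : groupType) (S : seq G)
  (genS : generates S) (h g k : G) :
  word_dist R genS g k <= word_dist R genS g h + word_dist R genS h k.
Proof.
rewrite /word_dist -natrD ler_nat.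
have -> : (g^-1 * k = (g^-1 * h) * (h^-1 * k))%g by rewrite mulgA -(mulgA g^-1%g) mulgV mulg1.
exact: word_lengthM.
Qed.

HB.instance Definition _ (R : realType) (G : groupType) (S : seq G)
  (genS : generates S) :=
  isMetric.Build R (@word_metric_space R G S genS)
    (@word_distxx R G S genS) (@word_dist_positivity R G S genS)
    (@word_dist_sym R G S genS) (@word_dist_triangle R G S genS).

(* Main.v *)
(** A Milnor-Schwarz argument with equivariance up to bounded error.  Given a
    near-action [psi] with orbit map [g |-> psi g x0], moving by [psi g^-1]
    shows that [d (psi g x0) (psi h x0)] and [d x0 (psi (g^-1 h) x0)] bound each
    other; properness and finiteness of word balls turn this into mutual bounds
    with the word length of [g^-1 h], so any [f] with [psi (f x) x0] near [x] is
    a coarse equivalence.  Conversely, left translation of [G] is conjugated to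
    [X] by a coarse equivalence [f] and a coarse inverse [k] of it:
    [psi g x = k (g * f x)]. *)
Require Import Defs.
From HB Require Import structures.
From mathcomp Require Import all_boot all_order all_algebra.
From mathcomp Require Import boolp classical_sets cardinality reals topology.
From mathcomp Require Import normedtype.
From mathcomp Require Import lra.

Set Implicit Arguments.
Unset Strict Implicit.
Unset Printing Implicit Defensive.

Import Order.TTheory GRing.Theory Num.Theory.

Local Open Scope classical_set_scope.
Local Open Scope ring_scope.

(** * Coarse embeddings without explicit control functions *)

Section UniformControl.
Context {R : realType} {X Y : metricType R} {I : Type}.

(** The bound is chosen before the index [i], since a near-action has one control pair for all group
    elements; a single map is the case of [unit]. *)
Definition uniformly_bornologous (F : I -> X -> Y) :=
  forall t : R, exists b : R, forall i x y,
    mdist x y <= t -> mdist (F i x) (F i y) <= b.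

Definition uniformly_expanding (F : I -> X -> Y) :=
  forall t : R, exists b : R, forall i x y,
    mdist (F i x) (F i y) <= t -> mdist x y <= b.

Lemma coarse_embedding_bornologous (F : I -> X -> Y) (rho_m rho_p : R -> R) :
  control_pair rho_m rho_p ->
  (forall i, coarse_embedding rho_m rho_p (F i)) -> uniformly_bornologous F.
Proof.
move=> [_ [_ rho_p_le] _] FP t; exists (rho_p t) => i x y xyt.
have /andP[_ /le_trans] := FP i x y; apply.
exact: rho_p_le (mdist_ge0 _ _) xyt.
Qed.

Lemma coarse_embedding_expanding (F : I -> X -> Y) (rho_m rho_p : R -> R) :
  control_pair rho_m rho_p ->
  (forall i, coarse_embedding rho_m rho_p (F i)) -> uniformly_expanding F.
Proof.
move=> [_ _ rho_m_oo] FP t.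
have [M [_ MP]] := (cvgryPgt _).1 rho_m_oo t.
exists M => i x y Fxyt; rewrite leNgt; apply/negP => /MP.
have /andP[lem _] := FP i x y.
by move=> /lt_le_trans/(_ lem)/lt_le_trans/(_ Fxyt); rewrite ltxx.
Qed.

(* Adjoining [t] (resp. [0]) to the set keeps the infimum (resp. supremum)
   meaningful when no pair of points is at distance [>= t] (resp. [<= t]). *)
Lemma coarse_embedding_controls (F : I -> X -> Y) :
  uniformly_bornologous F -> uniformly_expanding F ->
  exists rho_m rho_p : R -> R, control_pair rho_m rho_p /\
    forall i, coarse_embedding rho_m rho_p (F i).
Proof.
move=> Fborn Fexp.
pose A (t : R) : set R := [set u | u = t \/ exists i x y,
  t <= mdist x y /\ u = mdist (F i x) (F i y)].
pose B (t : R) : set R := [set u | u = 0 \/ exists i x y,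
  mdist x y <= t /\ u = mdist (F i x) (F i y)].
have A0 t : A t !=set0 by exists t; left.
have B0 t : B t !=set0 by exists 0; left.
have Alb t : 0 <= t -> lbound (A t) 0.
  by move=> t0 _ [->//|[i [x [y [_ ->]]]]]; exact: mdist_ge0.
have Bub t : has_ubound (B t).
  have [b bP] := Fborn t; exists (Num.max 0 b) => u.
  move=> [->|[i [x [y [xyt ->]]]]]; first by rewrite le_max lexx.
  by rewrite le_max (bP _ _ _ xyt) orbT.
exists (fun t => inf (A t)), (fun t => sup (B t)); split; first split.
- split=> [t t0|s t s0 st]; first exact: lb_le_inf (A0 t) (Alb t t0).
  apply: lb_le_inf => // u [->|[i [x [y [txy ->]]]]].
    apply: (@le_trans _ _ s) => //.
    by apply: inf_lbound; [exists 0; exact: Alb|left].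
  apply: inf_lbound; first by exists 0; exact: Alb.
  by right; exists i, x, y; split=> //; exact: le_trans txy.
- split=> [t t0|s t s0 st]; first by apply: ub_le_sup => //; left.
  apply: ge_sup => // u [->|[i [x [y [xys ->]]]]].
    by apply: ub_le_sup => //; left.
  apply: ub_le_sup => //; right; exists i, x, y; split=> //.
  exact: le_trans st.
(* Beyond [Num.max a b] the adjoined value [t] exceeds [a], and points at distance at least [t > b]
   cannot have images closer than [a]. *)
- apply/cvgryPge => a; have [b bP] := Fexp a.
  exists (Num.max a b); split; first exact: num_real.
  move=> t; rewrite gt_max => /andP[at_ bt].
  apply: lb_le_inf => // u [->|[i [x [y [txy ->]]]]]; first exact: ltW.
  rewrite leNgt; apply/negP => /ltW/bP xyb.
  by have := le_lt_trans (le_trans txy xyb) bt; rewrite ltxx.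
- move=> i x y; apply/andP; split.
    apply: inf_lbound; first by exists 0; apply: Alb; exact: mdist_ge0.
    by right; exists i, x, y.
  by apply: ub_le_sup => //; right; exists i, x, y.
Qed.

End UniformControl.

(** * Finite sets and word balls *)

Lemma finite_set_bounded (R : realType) (T : eqType) (A : set T) (F : T -> R) :
  finite_set A -> exists b, forall x, A x -> F x <= b.
Proof.
move=> /finite_seqP[s ->]; elim: s => [|y s [b bP]]; first by exists 0.
exists (Num.max (F y) b) => x /=; rewrite inE le_max => /orP[/eqP->|/bP->].
  by rewrite lexx.
by rewrite orbT.
Qed.

Section WordMetric.
Context {R : realType} {G : groupType} {S : seq G} (genS : generates S).
Local Notation W := (word_metric_space R genS).

Lemma word_mdistE (g h : W) :
  mdist g h = (word_length genS ((g : G)^-1 * (h : G))%g)%:R.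
Proof. by []. Qed.

Lemma word_mdistM (c g h : G) :
  mdist ((c * g)%g : W) ((c * h)%g : W) = mdist (g : W) (h : W).
Proof. by rewrite !word_mdistE invgM -mulgA mulKg. Qed.

Lemma finite_word_ball_nat (n : nat) :
  finite_set [set g : G | (word_length genS g <= n)%N].
Proof.
elim: n => [|n IHn].
  apply: (@sub_finite_set _ _ [set 1%g]); last exact: finite_set1.
  by move=> g /=; rewrite leqn0 => /eqP/word_length_eq0.
(* A nonempty word is a letter of the finite alphabet [T] followed by a shorter word. *)
pose T : set G := [set` S ++ [seq s^-1%g | s <- S]].
have finT : finite_set T by apply/finite_seqP; exists (S ++ [seq s^-1%g | s <- S]).
apply: (@sub_finite_set _ _ ([set g : G | (word_length genS g <= n)%N] `|`
  [set (s * g)%g | s in T & g in [set g : G | (word_length genS g <= n)%N]])).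
  move=> g /=; have [w <- [Sw gE]] := word_lengthP genS g.
  case: w Sw gE => [_ <-|s w /= /andP[sS Sw] <- wn].
    by left.
  right; exists s; first rewrite /T /= mem_cat.
    case/orP: sS => [->//|sVS]; apply/orP; right.
    by apply/mapP; exists s^-1%g; rewrite ?invgK.
  exists (\prod_(s <- w) s)%g; last by rewrite big_cons.
  by rewrite /= -ltnS (leq_ltn_trans _ wn) //; exact: word_length_le.
by rewrite finite_setU; split=> //; exact: finite_image2.
Qed.

Lemma finite_word_ball (t : R) :
  finite_set [set g : G | (word_length genS g)%:R <= t].
Proof.
apply: sub_finite_set (finite_word_ball_nat (Num.trunc t)) => g /= gt.
by rewrite truncn_ge_nat // (le_trans _ gt).
Qed.

End WordMetric.

(** * From a near-action to a coarse equivalence *)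

Section NearActionToEquivalence.
Context {R : realType} {X : metricType R} {G : groupType} {S : seq G}.
Variables (genS : generates S) (psi : G -> X -> X) (x0 : X).
Local Notation W := (word_metric_space R genS).

Lemma finite_orbit_return (t : R) : proper_near_action psi ->
  finite_set [set g | mdist (psi g x0) x0 <= t].
Proof.
(* Properness speaks of positive radii only, hence the 1. *)
move=> psiP; pose r := Num.max 1 t.
have [|M MP] := psiP r; first by rewrite lt_max ltr01.
have finM := card_le_finite (MP x0 x0) (finite_II M).
apply: sub_finite_set finM => g /= gt; exists (psi g x0); split.
  by exists x0 => //=; rewrite /mclosed_ball /= mdistxx le_max ler01.
by rewrite /mclosed_ball /= metric_sym le_max gt orbT.
Qed.

Lemma orbit_word_bound (t : R) :
  coarse_near_action psi -> proper_near_action psi ->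
  exists b : R, forall g h : G, mdist (psi g x0) (psi h x0) <= t ->
    mdist (g : W) (h : W) <= b.
Proof.
move=> [C [rm [rp [[C0 ctl] psi1 psiM psiE]]]] psiP.
have [b bP] := coarse_embedding_bornologous ctl psiE t.
(* Three errors [C]: splitting [psi (g^-1 h)], merging [psi g^-1 (psi g x0)] into [psi 1 x0], and
   replacing the latter by [x0]. *)
have [m mP] := finite_set_bounded (fun g => (word_length genS g)%:R : R)
  (finite_orbit_return (b + C *+ 3) psiP).
exists m => g h ght; rewrite word_mdistE; apply: mP => /=.
have := bP g^-1%g _ _ ght.
have := psiM x0 g^-1%g h; have := psiM x0 g^-1%g g; have := psi1 x0.
rewrite mulVg.
have := metric_triangle (psi (g^-1 * h)%g x0) (psi g^-1%g (psi h x0)) x0.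
have := metric_triangle (psi g^-1%g (psi h x0)) (psi g^-1%g (psi g x0)) x0.
have := metric_triangle (psi g^-1%g (psi g x0)) (psi 1%g x0) x0.
rewrite (metric_sym (psi g^-1%g (psi h x0)) (psi g^-1%g (psi g x0))).
rewrite (metric_sym (psi g^-1%g (psi g x0)) (psi 1%g x0)).
lra.
Qed.

(** The finitely many elements of a word ball move [x0] a bounded distance; [psi g] distorts this
    uniformly in [g], and [psi g (psi (g^-1 h) x0)] is within [C] of [psi h x0]. *)
Lemma word_orbit_bound (t : R) : coarse_near_action psi ->
  exists b : R, forall g h : G, mdist (g : W) (h : W) <= t ->
    mdist (psi g x0) (psi h x0) <= b.
Proof.
move=> [C [rm [rp [[C0 ctl] psi1 psiM psiE]]]].
have [m mP] := finite_set_bounded (fun g => mdist x0 (psi g x0))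
  (finite_word_ball genS t).
have [b bP] := coarse_embedding_bornologous ctl psiE m.
exists (b + C) => g h; rewrite word_mdistE => /mP/(bP g).
have := psiM x0 g (g^-1 * h)%g; rewrite mulVKg metric_sym.
have := metric_triangle (psi g x0) (psi g (psi (g^-1 * h)%g x0)) (psi h x0).
lra.
Qed.

Lemma orbit_inverse_coarse_equivalence (r : R) (f : X -> W) :
  coarse_near_action psi -> proper_near_action psi ->
  (forall x, mdist (psi (f x) x0) x < r) -> coarse_equivalence f.
Proof.
move=> psiA psiP fP; split.
  have [||rm [rp [ctl ctlf]]] :=
      @coarse_embedding_controls _ _ _ unit (fun=> f).
  - move=> t; have [b bP] := orbit_word_bound (t + r *+ 2) psiA psiP.
    exists b => _ x y xyt; apply: bP; have := fP x; have := fP y.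
    have := metric_triangle (psi (f x) x0) x (psi (f y) x0).
    have := metric_triangle x y (psi (f y) x0).
    rewrite (metric_sym y); lra.
  - move=> t; have [b bP] := word_orbit_bound t psiA.
    exists (b + r *+ 2) => _ x y /bP; have := fP x; have := fP y.
    have := metric_triangle x (psi (f x) x0) y.
    have := metric_triangle (psi (f x) x0) (psi (f y) x0) y.
    rewrite (metric_sym x (psi (f x) x0)); lra.
  by exists rm, rp; split=> //; exact: ctlf tt.
(* For [x = psi g x0], the orbit points of [f x] and [g] are within [r], so [f x] is close to
   [g]. *)
have [b bP] := orbit_word_bound r psiA psiP.
exists (Num.max 0 b) => [|g]; first by rewrite le_max lexx.
exists (psi g x0); rewrite le_max bP ?orbT //.
by rewrite metric_sym ltW.
Qed.

End NearActionToEquivalence.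

(** * From a coarse equivalence to a near-action *)

Section EquivalenceToNearAction.
Context {R : realType} {X : metricType R} {G : groupType} {S : seq G}.
Variables (genS : generates S).
Local Notation W := (word_metric_space R genS).
Variables (f : X -> W) (k : W -> X) (C : R).
Hypothesis fborn : uniformly_bornologous (fun _ : unit => f).
Hypothesis fexp : uniformly_expanding (fun _ : unit => f).
Hypothesis fk : forall g : W, mdist g (f (k g)) <= C.

Definition translation_conj (g : G) (x : X) : X := k (g * (f x : G))%g.

(** As [f (k g)] is within [C] of [g], expansion of [f] makes [k] bornologous, and conversely in the
    next lemma. *)
Lemma coarse_inverse_bornologous (t : R) :
  exists b : R, forall g h : W, mdist g h <= t -> mdist (k g) (k h) <= b.
Proof.
have [b bP] := fexp (t + C *+ 2); exists b => g h ght; apply: (bP tt).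
have := fk g; have := fk h.
have := metric_triangle (f (k g)) g (f (k h)).
have := metric_triangle g h (f (k h)).
rewrite (metric_sym (f (k g)) g); lra.
Qed.

Lemma coarse_inverse_expanding (t : R) :
  exists b : R, forall g h : W, mdist (k g) (k h) <= t -> mdist g h <= b.
Proof.
have [b bP] := fborn t; exists (b + C *+ 2) => g h /(bP tt).
have := fk g; have := fk h.
have := metric_triangle g (f (k g)) h.
have := metric_triangle (f (k g)) (f (k h)) h.
rewrite (metric_sym (f (k h)) h); lra.
Qed.

Lemma coarse_inverseK : exists b : R, forall x, mdist (k (f x)) x <= b.
Proof.
have [b bP] := fexp C; exists b => x; apply: (bP tt).
by rewrite metric_sym fk.
Qed.

(** Left translations are isometries of the word metric, so the bounds for [f] and [k] compose
    uniformly in [g]. *)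
Lemma translation_conj_near_action : coarse_near_action translation_conj.
Proof.
have [|| rm [rp [ctl ctlP]]] := @coarse_embedding_controls _ _ _ _ translation_conj.
- move=> t; have [b bP] := fborn t; have [c cP] := coarse_inverse_bornologous b.
  by exists c => g x y /(bP tt) xy; apply: cP; rewrite word_mdistM.
- move=> t; have [b bP] := coarse_inverse_expanding t; have [c cP] := fexp b.
  by exists c => g x y /bP; rewrite word_mdistM => /(cP tt).
have [b bP] := coarse_inverseK.
have [c cP] := coarse_inverse_bornologous C.
exists (Num.max 0 (Num.max b c)), rm, rp; split=> //.
- by split=> //; rewrite le_max lexx.
- by move=> x; rewrite /translation_conj mul1g !le_max bP orbT.
- move=> x g h; rewrite /translation_conj !le_max cP ?orbT //.
  by rewrite -mulgA word_mdistM fk.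
Qed.

Lemma translation_conj_cobounded : cobounded translation_conj.
Proof.
have [b bP] := coarse_inverseK; pose x0 := k 1%g.
exists x0, (Num.max 0 b + 1); split.
  by rewrite ltr_wpDl // le_max lexx.
(* This element translates [f x0] to [f y], so it sends [x0] to [k (f y)], which is near [y]. *)
move=> y; exists ((f y : G) * (f x0 : G)^-1)%g; rewrite /translation_conj mulgVK.
by rewrite (@le_lt_trans _ _ (Num.max 0 b)) ?ltrDl ?ltr01 // le_max bP orbT.
Qed.

(** If [z] near [x] is sent near [y], then [g * f x] is within [b] of [g * f z], which is within [C]
    of its image under [f] after [k], itself within [b] of [f y]. Hence [(g * f x)^-1 * f y] lies in
    a word ball whose radius is independent of [x] and [y]. *)
Lemma translation_conj_proper : proper_near_action translation_conj.
Proof.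
move=> r _; have [b bP] := fborn r.
have /finite_set_leP[M ballM] := finite_word_ball genS (b *+ 2 + C).
exists M => x y.
set A := (X in (X #<= _)%card).
(* [u] recovers [g] from [v = (g * f x)^-1 * f y], so counting [g] reduces to counting [v]. *)
pose u (v : G) : G := ((f y : G) * v^-1 * (f x : G)^-1)%g.
have -> : A = u @` (u @^-1` A).
  rewrite eqEsubset; split=> [g Ag|_ [v Av <-] //].
  have ug : u ((f x : G)^-1 * g^-1 * (f y : G))%g = g.
    by rewrite /u !invgM !invgK !mulgA mulgV mul1g mulgK.
  by exists ((f x : G)^-1 * g^-1 * (f y : G))%g => //=; rewrite ug.
apply: card_le_trans (card_image_le _ _) (card_le_trans _ ballM).
apply: subset_card_le => v [_ [[z xz <-] yz]] /=.
have := bP tt _ _ xz; have := bP tt _ _ yz.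
rewrite /translation_conj; set g := u v => yz' xz'.
have vE : v = ((g * (f x : G))^-1 * (f y : G))%g.
  by rewrite /g /u mulgVK invgM invgK mulgVK.
rewrite vE -(@word_mdistE R).
have := fk (g * (f z : G))%g.
have := metric_triangle (R := R) (T := W) (g * (f x : G))%g (g * (f z : G))%g (f y).
have := metric_triangle (R := R) (T := W) (g * (f z : G))%g
  (f (k (g * (f z : G))%g)) (f y).
rewrite word_mdistM (metric_sym (f (k _)) (f y)).
move: xz' yz'; lra.
Qed.

End EquivalenceToNearAction.

Theorem theorem2p12 (R : realType) (X : metricType R) (G : groupType)
    (S : seq G) (genS : generates S) (hX : coarsely_connected X) :
  (exists psi : G -> X -> X,
     [/\ coarse_near_action psi, proper_near_action psi & cobounded psi])
  <-> coarsely_equivalent X (word_metric_space R genS).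
Proof.
split.
  move=> [psi [psiA psiP [x0 [r [_ psiC]]]]].
  have [f fP] := choice psiC.
  by exists f; exact: orbit_inverse_coarse_equivalence psiA psiP fP.
move=> [f [[rm [rp [ctl ctlf]]] [C _ fC]]].
have [k kP] := choice fC.
have fborn := coarse_embedding_bornologous ctl (fun _ : unit => ctlf).
have fexp := coarse_embedding_expanding ctl (fun _ : unit => ctlf).
exists (translation_conj f k); split.
- exact: translation_conj_near_action fborn fexp kP.
- exact: translation_conj_proper fborn kP.
- exact: translation_conj_cobounded fexp kP.
Qed.
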